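(* Let $X$ be a compact complex manifold of dimension $k$, let $f:X\dashrightarrow X$ be a dominant meromorphic map, and let $(X_n,F_n,\pi_n,s_n)$ be a tower over $(X,f)$ as defined in the context, with projective limit $X_\infty$ endowed with the metric $\delta$. Then the map $\sigma:X_\infty\to X_\infty$ defined by $\sigma\big((x_n)_{n\ge 0}\big)=(s_n(x_n))_{n\ge 1}$ is continuous.
   Context: Dominant meromorphic maps. For a compact complex manifold $X$ of dimension $k$, a dominant meromorphic map $f:X\dashrightarrow X$ is given by an irreducible analytic subset $\Gamma(f)\subset X\times X$ of dimension $k$ (the graph) such that the restriction to $\Gamma(f)$ of the first projection $p_1$ is (holomorphic and) surjective with generic fibres reduced to one point, and the restriction to $\Gamma(f)$ of the second projection $p_2$ is surjective. The indeterminacy set $I(f)$ is the analytic set of points $x$ such that $p_1^{-1}(x)\cap\Gamma(f)$ has dimension $\ge 1$; it has codimension $\ge 2$ and $f$ is holomorphic outside it. Compositions of dominant meromorphic maps are taken in the meromorphic sense (closure of the graph over the set of points where the pointwise composition is defined), and two such maps are equal if they have the same graph. Tower over $(X,f)$. This means: $X_0=X$, $F_0=f$; a sequence $(X_n)_{n\ge0}$ of compact complex manifolds of dimension $k$; dominant meromorphic maps $F_n:X_n\dashrightarrow X_n$; and for each $n\ge1$ a holomorphic surjective map $\pi_n:X_n\to X_{n-1}$ whose generic fibres are reduced to one point and a holomorphic surjective map $s_n:X_n\to X_{n-1}$ such that $\pi_n\circ F_n=s_n=F_{n-1}\circ\pi_n$ (as meromorphic maps), and $$\{x\in X_{n-1}:\dim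 \pi_n^{-1}(x)\ge 1\}\subset I(F_{n-1}).$$ Projective limit. $X_\infty=\{(x_n)\in\prod_{n\ge0}X_n:\ \pi_n(x_n)=x_{n-1}\text{ for all }n\ge1\}$. Fix for each $n$ a metric $dist_n$ on $X_n$ inducing its topology and positive reals $\alpha_n$ with $\sum_{n\ge0}1/\alpha_n<\infty$; the metric on $X_\infty$ is $\delta(\widehat x,\widehat y)=\sum_{n\ge0}\frac{dist_n(x_n,y_n)}{\alpha_n\, diam(X_n)}$, where $diam(X_n)$ is the diameter of $X_n$ for $dist_n$. With it $X_\infty$ is compact. In the definition of $\sigma$, the component of $\sigma(\widehat x)$ in $X_{n-1}$ is $s_n(x_n)$, for $n\ge1$; this sequence belongs to $X_\infty$. *)

(* Defs.v *)
(* R[i] is the field of complex numbers over R : realType. *)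
From HB Require Import structures.
From mathcomp Require Import all_boot all_order all_algebra.
From mathcomp Require Import complex.
From mathcomp Require Import all_classical all_reals all_analysis.

Set Implicit Arguments.
Unset Strict Implicit.
Unset Printing Implicit Defensive.

Import Order.TTheory GRing.Theory Num.Theory.
Import numFieldNormedType.Exports.

Local Open Scope classical_set_scope.
Local Open Scope ring_scope.

(* A homeomorphism from an open subset of M onto an open subset of E; the     *)
(* values of chart_map (resp. chart_inv) outside chart_dom (resp. its image)  *)
(* are irrelevant.                                                            *)
Record chart (R : realType) (M : topologicalType) (E : normedModType R[i]) :=
  Chart {
    chart_dom : set M ;
    chart_map :> M -> E ;
    chart_inv : E -> M ;
    chart_dom_open : open chart_dom ;
    chart_img_open : open (chart_map @` chart_dom) ;
    chartK : forall x, chart_dom x -> chart_inv (chart_map x) = x ;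
    chart_map_continuous : forall x, chart_dom x ->
      {for x, continuous chart_map} ;
    chart_inv_continuous : forall x, chart_dom x ->
      {for chart_map x, continuous chart_inv} }.

(* The change of charts psi \o phi^-1 is holomorphic: differentiable over     *)
(* R[i] is Frechet differentiability with an R[i]-linear differential.        *)
Definition holomorphic_change (R : realType) (M : topologicalType)
    (E F : normedModType R[i]) (phi : chart M E) (psi : chart M F) : Prop :=
  forall x, chart_dom phi x -> chart_dom psi x ->
    differentiable (psi \o chart_inv phi) (phi x).

(* Second countability is not required: only compact manifolds are considered *)
(* below, for which it is automatic.                                          *)
Record complex_manifold (R : realType) (E : normedModType R[i]) :=
  ComplexManifold {
    cm_space :> topologicalType ;
    cm_hausdorff : hausdorff_space cm_space ;
    atlas : set (chart cm_space E) ;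
    atlas_cover : forall x, exists2 phi, atlas phi & chart_dom phi x ;
    atlas_holomorphic : forall phi psi, atlas phi -> atlas psi ->
      holomorphic_change phi psi }.
Arguments atlas {R E} c.

Record compact_complex_manifold (R : realType) (k : nat) :=
  CompactComplexManifold {
    ccm_manifold :> complex_manifold 'rV[R[i]]_k ;
    ccm_compact : compact [set: ccm_manifold] }.

Section product_manifold.
Context (R : realType) (E F : normedModType R[i]).

Section product_chart.
Context (M N : topologicalType) (phi : chart M E) (psi : chart N F).

Let dom : set (M * N) := chart_dom phi `*` chart_dom psi.
Let map (p : M * N) : E * F := (phi p.1, psi p.2).
Let inv (q : E * F) : M * N := (chart_inv phi q.1, chart_inv psi q.2).

Lemma continuous_prod_map (A B A' B' : topologicalType) (f : A -> A')
    (g : B -> B') (p : A * B) : {for p.1, continuous f} ->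
  {for p.2, continuous g} ->
  {for p, continuous (fun q : A * B => (f q.1, g q.2))}.
Proof.
move=> fc gc; apply: cvg_pair => /=.
- exact: (continuous_comp (f := @fst A B) (@cvg_fst _ _ _ _ _) fc).
- exact: (continuous_comp (f := @snd A B) (@cvg_snd _ _ _ _ _) gc).
Qed.

Lemma open_setX (A B : topologicalType) (U : set A) (V : set B) :
  open U -> open V -> open (U `*` V).
Proof.
rewrite !openE => Uo Vo p [/Uo Up /Vo Vp].
by exists (U, V).
Qed.

Let dom_open : open dom.
Proof. by apply: open_setX; exact: chart_dom_open. Qed.

Let img_open : open (map @` dom).
Proof.
suff -> : map @` dom = (phi @` chart_dom phi) `*` (psi @` chart_dom psi).
  by apply: open_setX; exact: chart_img_open.
apply/seteqP; split=> [_ [[x y] [/= dx dy] <-]|[_ _] [[/= x dx <-] [y dy <-]]].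
  by split; [exists x | exists y].
by exists (x, y).
Qed.

Let mapK p : dom p -> inv (map p) = p.
Proof. by case: p => x y [/= dx dy]; rewrite /inv /map /= !chartK. Qed.

Let map_continuous p : dom p -> {for p, continuous map}.
Proof. by move=> [? ?]; apply: continuous_prod_map; exact: chart_map_continuous. Qed.

Let inv_continuous p : dom p -> {for map p, continuous inv}.
Proof. by move=> [? ?]; apply: continuous_prod_map; exact: chart_inv_continuous. Qed.

Definition prod_chart : chart (M * N)%type (E * F)%type :=
  Chart dom_open img_open mapK map_continuous inv_continuous.

End product_chart.

Context (M : complex_manifold E) (N : complex_manifold F).

Let prod_atlas : set (chart (M * N)%type (E * F)%type) :=
  [set prod_chart phi psi | phi in atlas M & psi in atlas N].

Let prod_hausdorff : hausdorff_space (M * N)%type.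
Proof.
move=> p q clpq; rewrite [p]surjective_pairing [q]surjective_pairing.
congr pair; apply: cm_hausdorff => U V Up Vq.
- have [] := clpq (fst @^-1` U) (fst @^-1` V); last by move=> z [? ?]; exists z.1.
  + exact: (@cvg_fst _ _ _ _ _ U).
  + exact: (@cvg_fst _ _ _ _ _ V).
- have [] := clpq (snd @^-1` U) (snd @^-1` V); last by move=> z [? ?]; exists z.2.
  + exact: (@cvg_snd _ _ _ _ _ U).
  + exact: (@cvg_snd _ _ _ _ _ V).
Qed.

Let prod_cover p : exists2 chi, prod_atlas chi & chart_dom chi p.
Proof.
have [phi aphi dphi] := atlas_cover p.1; have [psi apsi dpsi] := atlas_cover p.2.
by exists (prod_chart phi psi) => //; exists phi => //; exists psi.
Qed.

Let prod_holomorphic chi chi' : prod_atlas chi -> prod_atlas chi' ->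
  holomorphic_change chi chi'.
Proof.
move=> [phi aphi [psi apsi <-]] [phi' aphi' [psi' apsi' <-]] [x y] [/= dx dy].
move=> [/= dx' dy'].
have fst_diff (z : E * F) : differentiable (@fst E F) z.
  by apply: linear_differentiable => ?; exact: cvg_fst.
have snd_diff (z : E * F) : differentiable (@snd E F) z.
  by apply: linear_differentiable => ?; exact: cvg_snd.
pose f1 := (phi' \o chart_inv phi) \o @fst E F.
pose f2 := (psi' \o chart_inv psi) \o @snd E F.
apply: (@differentiable_pair _ _ _ _ f1 f2).
- by apply: differentiable_comp => //; exact: atlas_holomorphic.
- by apply: differentiable_comp => //; exact: atlas_holomorphic.
Qed.

Definition prod_manifold : complex_manifold (E * F)%type :=
  ComplexManifold prod_hausdorff prod_cover prod_holomorphic.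

End product_manifold.

Section holomorphic.
Context (R : realType).

Definition holomorphic_on (E F : normedModType R[i]) (M : complex_manifold E)
    (W : set M) (g : M -> F) : Prop :=
  forall phi x, atlas M phi -> chart_dom phi x -> W x ->
    differentiable (g \o chart_inv phi) (phi x).

Definition holomorphic_map (E F : normedModType R[i]) (M : complex_manifold E)
    (N : complex_manifold F) (f : M -> N) : Prop :=
  continuous f /\
  forall phi psi x, atlas M phi -> atlas N psi ->
    chart_dom phi x -> chart_dom psi (f x) ->
    differentiable (psi \o f \o chart_inv phi) (phi x).

End holomorphic.

Section analytic_sets.
Context (R : realType) (E : normedModType R[i]) (M : complex_manifold E).

(* Locally at every point of M (not only of A, so that A is closed), the set  *)
(* of common zeros of finitely many holomorphic functions g_1, ..., g_m.      *)
Definition analytic (A : set M) : Prop :=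
  forall p, exists W : set M, [/\ open W, W p &
    exists (m : nat) (g : M -> 'rV[R[i]]_m),
      holomorphic_on W g /\ A `&` W = [set x | W x /\ g x = 0]].

Definition irreducible_analytic (A : set M) : Prop :=
  [/\ analytic A, A !=set0 & forall A1 A2, analytic A1 -> analytic A2 ->
    A = A1 `|` A2 -> A = A1 \/ A = A2].

(* Near p, A is a complex submanifold of dimension d: some holomorphic chart  *)
(* chi of M at p with values in C^d x C^e maps A onto the slice C^d x {0}.    *)
Definition regular_point (A : set M) (d : nat) (p : M) : Prop :=
  A p /\ exists (e : nat) (chi : chart M ('rV[R[i]]_d * 'rV[R[i]]_e)%type),
    [/\ chart_dom chi p,
        forall phi, atlas M phi ->
          holomorphic_change phi chi /\ holomorphic_change chi phi &
        forall x, chart_dom chi x -> (A x <-> (chi x).2 = 0)].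

(* The dimension of an analytic set is the largest dimension of A at its      *)
(* regular points (which are dense in A).                                     *)
Definition dim_ge (A : set M) (d : nat) : Prop :=
  exists e p, (d <= e)%N /\ regular_point A e p.

Definition has_dim (A : set M) (d : nat) : Prop :=
  dim_ge A d /\ ~ dim_ge A d.+1.

Definition generic (P : M -> Prop) : Prop :=
  exists Z : set M, [/\ analytic Z, Z^° = set0 & forall x, ~ Z x -> P x].

End analytic_sets.

Section meromorphic_maps.
Context (R : realType).

Definition fiber1 (S T : Type) (G : set (S * T)) (x : S) : set (S * T) :=
  [set p | G p /\ p.1 = x].

(* X is not assumed connected: this follows from the irreducibility of the    *)
(* graph and the surjectivity of its first projection.                        *)
Record dominant_map (k : nat) (X : compact_complex_manifold R k) :=
  DominantMap {
    mgraph : set (prod_manifold X X) ;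
    mgraph_irreducible : irreducible_analytic mgraph ;
    mgraph_dim : has_dim mgraph k ;
    mgraph_fst_surj : fst @` mgraph = [set: X] ;
    mgraph_fst_generic :
      generic (fun x : X => exists! p, fiber1 mgraph x p) ;
    mgraph_snd_surj : snd @` mgraph = [set: X] }.

Definition fgraph_of (S T : Type) (h : S -> T) : set (S * T) :=
  [set p | p.2 = h p.1].

Context (k : nat).
Implicit Types X Y Z : compact_complex_manifold R k.

Definition indeterminacy X Y (G : set (prod_manifold X Y)) : set X :=
  [set x | dim_ge (fiber1 G x : set (prod_manifold X Y)) 1].

(* Graph of the pointwise composition, first G then H, over the points x      *)
(* outside I(G) whose image y is outside I(H).                                *)
Definition pointwise_comp X Y Z (G : set (prod_manifold X Y))
    (H : set (prod_manifold Y Z)) : set (prod_manifold X Z) :=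
  [set p | ~ indeterminacy G p.1 /\
    exists y, [/\ G (p.1, y), ~ indeterminacy H y & H (y, p.2)]].

Definition mcomp X Y Z (G : set (prod_manifold X Y))
    (H : set (prod_manifold Y Z)) : set (prod_manifold X Z) :=
  closure (pointwise_comp G H).

(* Index shift: tower_pi n and tower_s n are the maps pi_(n+1) and s_(n+1),   *)
(* from X_(n+1) to X_n.                                                       *)
Record tower X (f : dominant_map X) := Tower {
  tower_space : nat -> compact_complex_manifold R k ;
  tower_map : forall n, dominant_map (tower_space n) ;
  tower_base : existT (@dominant_map k) (tower_space 0) (tower_map 0) =
               existT (@dominant_map k) X f ;
  tower_pi : forall n, tower_space n.+1 -> tower_space n ;
  tower_s : forall n, tower_space n.+1 -> tower_space n ;
  tower_pi_holomorphic : forall n, holomorphic_map (@tower_pi n) ;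
  tower_pi_surj : forall n, range (@tower_pi n) = setT ;
  tower_pi_generic : forall n,
    generic (fun x : tower_space n => exists! y, tower_pi y = x) ;
  tower_s_holomorphic : forall n, holomorphic_map (@tower_s n) ;
  tower_s_surj : forall n, range (@tower_s n) = setT ;
  tower_pi_comp : forall n,
    mcomp (mgraph (tower_map n.+1)) (fgraph_of (@tower_pi n)) =
    fgraph_of (@tower_s n) ;
  tower_comp_pi : forall n,
    mcomp (fgraph_of (@tower_pi n)) (mgraph (tower_map n)) =
    fgraph_of (@tower_s n) ;
  tower_exceptional : forall n,
    [set x | dim_ge (@tower_pi n @^-1` [set x]) 1] `<=`
    indeterminacy (mgraph (tower_map n)) }.

End meromorphic_maps.

Section projective_limit.
Context (R : realType) (k : nat).

Lemma indeterminacy_fgraph (X Y : compact_complex_manifold R k) (h : X -> Y)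
  (x : X) : ~ indeterminacy (fgraph_of h : set (prod_manifold X Y)) x.
Proof.
move=> [d [p [d_gt0 [Ap [e [chi [dp _ chiA]]]]]]].
have Aeq q : fiber1 (fgraph_of h) x q -> q = (x, h x).
  by case: q => a b []; rewrite /fgraph_of /= => -> ->.
have [r /= r0 rU] : nbhs_ball (chi p) (chi @` chart_dom chi).
  by apply/nbhs_ballP; have := chart_img_open chi; rewrite openE; apply; exists p.
pose v : 'rV[R[i]]_d := const_mx 1.
have v0 : v != 0.
  apply/eqP => /rowP/(_ (Ordinal d_gt0)); rewrite !mxE; exact/eqP/oner_neq0.
have nv0 : 0 < `|v| by rewrite normr_gt0.
pose w : 'rV[R[i]]_d := (r / 2 / `|v|) *: v.
have w0 : w != 0 by rewrite scaler_eq0 negb_or v0 andbT !mulf_neq0// ?invr_neq0// ?gt_eqF.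
have [|q dq chiq] := rU ((chi p).1 + w, (chi p).2).
  split => /=; last exact: ballxx.
  rewrite -ball_normE /= opprD addNKr normrN normrZ ger0_norm; last first.
    by rewrite !divr_ge0// ltW.
  by rewrite divfK ?gt_eqF// ltr_pdivrMr// ltr_pMr// ltr1n.
have Aq : fiber1 (fgraph_of h) x q by apply/chiA => //; rewrite chiq; exact/chiA.
move: chiq; rewrite (Aeq _ Aq) -(Aeq _ Ap) => /(congr1 fst)/= /eqP.
by rewrite -subr_eq0 opprD addNKr oppr_eq0 (negPf w0).
Qed.

Context (X : compact_complex_manifold R k) (f : dominant_map X) (T : tower f).

Record proj_limit := ProjLimit {
  coord :> forall n, tower_space T n ;
  coordP : forall n, tower_pi (coord n.+1) = coord n }.

Lemma proj_limit_ext (x y : proj_limit) : (forall n, x n = y n) -> x = y.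
Proof.
case: x y => [x xP] [y yP] /= xy; have exy := functional_extensionality_dep xy.
by case: _ / exy yP => yP; congr ProjLimit; exact: Prop_irrelevance.
Qed.

Lemma tower_pi_s n (y : tower_space T n.+2) :
  tower_pi (tower_s y) = tower_s (tower_pi y).
Proof.
have pc m : continuous (@tower_pi _ _ _ _ T m) by case: (tower_pi_holomorphic T m).
have sc m : continuous (@tower_s _ _ _ _ T m) by case: (tower_s_holomorphic T m).
pose S (z : tower_space T n.+2) := tower_pi (tower_s z) = tower_s (tower_pi z).
have S_dense (U : set (tower_space T n.+2)) : nbhs y U -> exists2 z, U z & S z.
  move=> Uy; have ys : fgraph_of (@tower_s _ _ _ _ T n.+1) (y, tower_s y) by [].
  move: (ys); rewrite -tower_comp_pi => /(_ (fst @^-1` U)) [].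
    exact: (@cvg_fst _ _ _ _ _ U).
  move=> [z t] [Bz /= Uz]; exists z => //.
  have := subset_closure Bz; rewrite -/(mcomp _ _) tower_comp_pi.
  rewrite /fgraph_of /= => tz.
  move: Bz => [_ [u []]]; rewrite /fgraph_of /= => -> Iz Fz.
  have /subset_closure : pointwise_comp (mgraph (tower_map T n.+1))
      (fgraph_of (@tower_pi _ _ _ _ T n)) (tower_pi z, tower_pi t).
    by split=> //=; exists t; split=> //; exact: indeterminacy_fgraph.
  by rewrite -/(mcomp _ _) tower_pi_comp /fgraph_of /S /= tz.
apply: cm_hausdorff => A B Ay By.
have [|z [Az Bz] Sz] := S_dense ((fun z => tower_pi (tower_s z)) @^-1` A `&`
    (fun z => tower_s (tower_pi z)) @^-1` B); last first.
  by exists (tower_pi (tower_s z)); split=> //; rewrite Sz.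
apply: filterI.
- exact: (continuous_comp (sc n.+1 y) (pc n _) Ay).
- exact: (continuous_comp (pc n.+1 y) (sc n _) By).
Qed.

Definition sigma (x : proj_limit) : proj_limit :=
  @ProjLimit (fun n => tower_s (x n.+1))
    (fun n => etrans (tower_pi_s (x n.+2)) (congr1 _ (coordP x n.+1))).

End projective_limit.
Arguments sigma {R k X f} T x.

Definition metrizes (R : realType) (S : topologicalType) (d : S -> S -> R) :
    Prop :=
  [/\ forall x y, d x y = 0 <-> x = y,
      forall x y, d x y = d y x,
      forall x y z, d x z <= d x y + d y z &
      forall x (U : set S), nbhs x U <->
        exists2 e : R, 0 < e & [set y | d x y < e] `<=` U].

Definition diam (R : realType) (S : Type) (d : S -> S -> R) : R :=
  sup [set d p.1 p.2 | p in [set: S * S]].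

Record limit_metric (R : realType) (k : nat) (X : compact_complex_manifold R k)
    (f : dominant_map X) (T : tower f) := LimitMetric {
  dist : forall n, tower_space T n -> tower_space T n -> R ;
  alpha : nat -> R ;
  dist_metrizes : forall n, metrizes (@dist n) ;
  alpha_gt0 : forall n, 0 < alpha n ;
  alpha_summable : cvgn (series (fun n => (alpha n)^-1)) }.

(* A copy of X_oo indexed by D, on which delta is declared as the metric. *)
Definition metric_limit (R : realType) (k : nat)
    (X : compact_complex_manifold R k) (f : dominant_map X) (T : tower f)
    (D : limit_metric T) : Type := proj_limit T.

Section limit_metric_space.
Context (R : realType) (k : nat) (X : compact_complex_manifold R k)
  (f : dominant_map X) (T : tower f) (D : limit_metric T).

(* When X_n is a point (k = 0), diam X_n = 0 and the term is 0, as x / 0 = 0. *)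
Definition delta_term (x y : proj_limit T) (n : nat) : R :=
  dist D (x n) (y n) / (alpha D n * diam (@dist _ _ _ _ _ D n)).

Definition delta (x y : proj_limit T) : R := limn (series (delta_term x y)).

Lemma dist_ge0 n (a b : tower_space T n) : 0 <= dist D a b.
Proof.
have [d0 dC dD _] := dist_metrizes D n.
by have := dD a b a; rewrite (d0 a a).2 // (dC b a) -mulr2n pmulrn_lge0.
Qed.

Lemma dist_le_diam n (a b : tower_space T n) :
  dist D a b <= diam (@dist _ _ _ _ _ D n).
Proof.
have [d0 dC dD dN] := dist_metrizes D n.
have dcont : continuous (dist D a : tower_space T n -> R).
  move=> c; apply/cvgrPdist_lt => e e0; apply/dN; exists e => // c' /= cc'.
  apply: le_lt_trans cc'; rewrite ler_norml lerBlDr lerNl opprB lerBlDr.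
  by rewrite addrC dD/= (dC c c') addrC dD.
have : compact (dist D a @` [set: tower_space T n]).
  apply: continuous_compact; last exact: ccm_compact.
  exact: continuous_subspaceT.
move=> /compact_bounded [M [_ MP]].
have {}MP c : dist D a c <= M + 1.
  by apply: le_trans (ler_norm _) _; apply: MP; [rewrite ltrDl|exists c].
apply: ub_le_sup; last by exists (a, b).
exists (M + 1 + (M + 1)) => _ [[c c'] _ <-] /=.
by rewrite (le_trans (dD c a c'))// lerD// dC.
Qed.

Lemma delta_term_ge0 x y n : 0 <= delta_term x y n.
Proof.
rewrite divr_ge0 ?dist_ge0// mulr_ge0 ?(ltW (alpha_gt0 D n))//.
exact: le_trans (dist_ge0 _ _) (dist_le_diam (x n) (y n)).
Qed.

Lemma is_cvg_delta x y : cvgn (series (delta_term x y)).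
Proof.
apply: (@series_le_cvg R _ (fun n => (alpha D n)^-1)) => [n|n|n|]; [exact: delta_term_ge0| | |exact: alpha_summable].
  by rewrite invr_ge0 ltW// alpha_gt0.
rewrite /delta_term; have [->|dn0] := eqVneq (diam (@dist _ _ _ _ _ D n)) 0.
  by rewrite mulr0 invr0 mulr0 invr_ge0 ltW// alpha_gt0.
have dgt0 : 0 < diam (@dist _ _ _ _ _ D n).
  by rewrite lt_neqAle eq_sym dn0 (le_trans (dist_ge0 (x n) (y n)))// dist_le_diam.
rewrite invfM mulrCA ler_piMr ?invr_ge0 ?(ltW (alpha_gt0 D n))//.
by rewrite ler_pdivrMr// mul1r dist_le_diam.
Qed.

HB.instance Definition _ := gen_eqMixin (metric_limit D).
HB.instance Definition _ := gen_choiceMixin (metric_limit D).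

Let delta_xx (x : metric_limit D) : delta x x = 0.
Proof.
rewrite /delta (_ : delta_term x x = fun=> 0); last first.
  apply/funext => n; have [d0 _ _ _] := dist_metrizes D n.
  by rewrite /delta_term (d0 _ _).2// mul0r.
rewrite (_ : series _ = fun=> 0) ?lim_cst//.
by apply/funext => n; rewrite /series /= big1.
Qed.

Let delta_positivity (x y : metric_limit D) : delta x y = 0 -> x = y.
Proof.
move=> xy0; apply: proj_limit_ext => n; have [d0 _ _ _] := dist_metrizes D n.
apply/d0/eqP; rewrite eq_le dist_ge0 andbT.
have nd : nondecreasing_seq (series (delta_term x y)).
  by apply/nondecreasing_series => i _ _; exact: delta_term_ge0.
have : delta_term x y n <= 0.
  rewrite -xy0 (le_trans _ (nondecreasing_cvgn_le nd (is_cvg_delta (x:=x) (y:=y)) n.+1))//.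
  by rewrite /series /= big_nat_recr//= lerDr sumr_ge0// => i _; exact: delta_term_ge0.
have /orP[/eqP dn0 _|dn0] : (diam (@dist _ _ _ _ _ D n) == 0) ||
    (diam (@dist _ _ _ _ _ D n) != 0) by exact: orbN.
  by rewrite -dn0 dist_le_diam.
rewrite /delta_term pmulr_lle0// invr_gt0 mulr_gt0 ?alpha_gt0//.
by rewrite lt_neqAle eq_sym dn0 (le_trans (dist_ge0 (x n) (y n)))// dist_le_diam.
Qed.

Let delta_sym (x y : metric_limit D) : delta x y = delta y x.
Proof.
rewrite /delta; congr (limn (series _)); apply/funext => n.
by have [_ dC _ _] := dist_metrizes D n; rewrite /delta_term dC.
Qed.

Let delta_triangle (y x z : metric_limit D) : delta x z <= delta x y + delta y z.
Proof.
rewrite /delta -limD; try exact: is_cvg_delta.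
apply: ler_lim; [exact: is_cvg_delta|apply: is_cvgD; exact: is_cvg_delta|].
near=> m.
change (series (delta_term x z) m <=
  series (delta_term x y) m + series (delta_term y z) m).
rewrite /series /= -big_split/=; apply: ler_sum => n _.
have [_ _ dD _] := dist_metrizes D n.
rewrite -mulrDl ler_wpM2r// invr_ge0 mulr_ge0 ?(ltW (alpha_gt0 D n))//.
exact: le_trans (dist_ge0 _ _) (dist_le_diam (x n) (y n)).
Unshelve. all: by end_near. Qed.

HB.instance Definition _ := isMetric.Build R (metric_limit D)
  delta_xx delta_positivity delta_sym delta_triangle.

End limit_metric_space.

(* Main.v *)
Require Import Defs.
From mathcomp Require Import all_boot all_order all_algebra.
From mathcomp Require Import all_classical all_reals all_analysis.

(** The point is that [delta] induces on the projective limit the topology of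
    coordinatewise convergence, in the metrics [dist D n] and hence in the
    topologies of the [X_n].

    One half is that a coordinate is Lipschitz for [delta]
    ([dist_le_delta]), because one term of a nonnegative series is at most its
    sum. The other half ([cvg_metric_limit]) is a Weierstrass M-test: the n-th
    term of [delta] is at most [1 / alpha n] at every pair of points, so the
    tails of [delta] are uniformly small and [delta] is governed by finitely
    many coordinates.

    Continuity of [sigma] can therefore be tested on coordinates. Its n-th
    coordinate factors as the projection to [X_(n+1)] followed by [s_(n+1)],
    which is holomorphic and in particular continuous. *)

Set Implicit Arguments.
Unset Strict Implicit.
Unset Printing Implicit Defensive.

Import Order.TTheory GRing.Theory Num.Theory.
Import numFieldNormedType.Exports.

Local Open Scope classical_set_scope.
Local Open Scope ring_scope.

Local Notation coord := Defs.coord.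

Lemma le_series_limn (R : realType) (u : R^nat) n :
  (forall i, 0 <= u i) -> cvgn (series u) -> series u n <= limn (series u).
Proof.
move=> u0 cu; apply: nondecreasing_cvgn_le cu n.
by apply/nondecreasing_series => i _ _; exact: u0.
Qed.

(** Comparing the tails of the two series term by term turns summability of
    [a] into a truncation error for [u] that does not depend on [u]. *)
Lemma limn_series_le_dominated (R : realType) (u a : R^nat) N :
  (forall i, 0 <= u i <= a i) -> cvgn (series u) -> cvgn (series a) ->
  limn (series u) <= series u N + (limn (series a) - series a N).
Proof.
move=> ua cu ca; apply: limr_le => //; near=> m.
have Nm : (N <= m)%N by near: m; exact: nbhs_infty_ge.
have a0 i : 0 <= a i by have /andP[/le_trans] := ua i; apply.
have Pm := le_series_limn m a0 ca.
rewrite -lerBlDl; apply: le_trans (lerB Pm (lexx (series a N))).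
rewrite !sub_series_geq//.
by apply: ler_sum => i _; case/andP: (ua i).
Unshelve. all: by end_near. Qed.

Lemma metrizes_cvgP (R : realType) (S : topologicalType) (d : S -> S -> R)
    (A : Type) (F : set_system A) {FF : Filter F} (h : A -> S) (x : S) :
  metrizes d ->
  h @ F --> x <-> forall e, 0 < e -> \forall s \near F, d x (h s) < e.
Proof.
move=> [_ _ _ dN]; split=> [hx e e0|hx U /dN[e e0 eU]].
  by apply: (hx [set y | d x y < e]); apply/dN; exists e.
by rewrite /= nbhs_filterE /=; apply: filterS (hx e e0) => s; exact: eU.
Qed.

Section metric_limit_topology.
Context (R : realType) (k : nat) (X : compact_complex_manifold R k)
  (f : dominant_map X) (T : tower f) (D : limit_metric T).
Implicit Types (x y : metric_limit D) (n : nat).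

Let diam_n n : R := diam (@dist _ _ _ _ _ D n).

Lemma diam_ge0 x n : 0 <= diam_n n.
Proof.
by apply: le_trans (dist_ge0 D (coord x n) (coord x n)) _; exact: dist_le_diam.
Qed.

Lemma dist_delta_term x y n :
  dist D (coord x n) (coord y n) = delta_term D x y n * (alpha D n * diam_n n).
Proof.
have [dn0|dn0] := eqVneq (diam_n n) 0.
  (* When [X_n] has diameter 0, both sides vanish. *)
  apply/eqP; rewrite dn0 !mulr0 eq_le dist_ge0 andbT -dn0.
  exact: dist_le_diam.
by rewrite divfK// mulf_neq0// gt_eqF// alpha_gt0.
Qed.

Lemma delta_term_le x y n : 0 <= delta_term D x y n <= (alpha D n)^-1.
Proof.
rewrite delta_term_ge0 /=.
have [dn0|dn0] := eqVneq (diam_n n) 0.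
  rewrite /delta_term -/(diam_n n) dn0 mulr0 invr0 mulr0 invr_ge0.
  exact/ltW/alpha_gt0.
have dgt0 : 0 < diam_n n by rewrite lt_neqAle eq_sym dn0 (diam_ge0 x).
rewrite /delta_term invfM mulrCA ler_piMr ?invr_ge0 ?(ltW (alpha_gt0 D n))//.
by rewrite ler_pdivrMr// mul1r dist_le_diam.
Qed.

Lemma delta_term_le_delta x y n : delta_term D x y n <= delta D x y.
Proof.
apply: le_trans (le_series_limn n.+1 (delta_term_ge0 D x y)
  (is_cvg_delta (x := x) (y := y))).
rewrite /series /= big_nat_recr//= lerDr.
by apply: sumr_ge0 => i _; exact: delta_term_ge0.
Qed.

Lemma dist_le_delta x y n :
  dist D (coord x n) (coord y n) <= delta D x y * (alpha D n * diam_n n).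
Proof.
rewrite dist_delta_term ler_wpM2r ?delta_term_le_delta//.
by rewrite mulr_ge0 ?(diam_ge0 x)// ltW// alpha_gt0.
Qed.

Lemma cvg_deltaP (A : Type) (F : set_system A) {FF : Filter F}
    (h : A -> metric_limit D) x :
  h @ F --> x <-> forall e, 0 < e -> \forall s \near F, delta D x (h s) < e.
Proof. exact: metricType_numDomainType.cvgrPdist_lt. Qed.

Lemma coord_continuous n :
  continuous (fun x : metric_limit D => coord x n : tower_space T n).
Proof.
move=> x.
apply/(metrizes_cvgP (FF := nbhs_filter x) _ _ (dist_metrizes D n)) => e e0.
pose c : R := alpha D n * diam_n n.
have c0 : 0 <= c by rewrite mulr_ge0 ?(diam_ge0 x)// ltW// alpha_gt0.
(* [c + 1] replaces the Lipschitz constant [c], which may be 0. *)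
have c1 : 0 < c + 1 by rewrite ltr_wpDl.
have e1 : 0 < e / (c + 1) by rewrite divr_gt0.
apply: filterS ((cvg_deltaP (FF := nbhs_filter x) id x).1 cvg_id _ e1) => y /=.
rewrite ltr_pdivlMr// => xy.
apply: le_lt_trans xy; apply: le_trans (dist_le_delta _ _ _) _.
rewrite ler_wpM2l ?lerDl//.
exact: le_trans (delta_term_ge0 D x y 0) (delta_term_le_delta _ _ _).
Qed.

(** Only finitely many coordinates matter up to a given error, by the
    truncation bound [limn_series_le_dominated] with [a n = 1 / alpha n], and
    each of the remaining finitely many terms tends to 0. *)
Lemma cvg_metric_limit (A : Type) (F : set_system A) {FF : Filter F}
    (h : A -> metric_limit D) x :
  (forall n, coord (h s) n @[s --> F] --> (coord x n : tower_space T n)) ->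
  h @ F --> x.
Proof.
move=> hx; apply/cvg_deltaP => e e0.
pose a n := (alpha D n)^-1.
have ca : cvgn (series a) by exact: alpha_summable.
have e20 : 0 < e / 2 by rewrite divr_gt0.
have term_cvg n : delta_term D x (h s) n @[s --> F] --> (0 : R).
  rewrite -[0](mul0r ((alpha D n * diam_n n)^-1)); apply: cvgMl.
  apply/cvgrPdist_lt => r r0.
  have /(metrizes_cvgP _ _ (dist_metrizes D n))/(_ r r0) := hx n.
  by apply: filterS => s; rewrite sub0r normrN ger0_norm// dist_ge0.
have [N aN] : exists N, limn (series a) - series a N < e / 2.
  have /cvgrPdist_lt/(_ _ e20)[N _ aN] := ca.
  exists N; apply: le_lt_trans (ler_norm _) _.
  exact: (aN N (leqnn N)).
have part_cvg : series (delta_term D x (h s)) N @[s --> F] --> (0 : R).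
  have -> : 0 = \sum_(0 <= i < N) (0 : R) by rewrite big1.
  by apply: cvg_big => [|i _]; [exact: add_continuous|exact: term_cvg].
have /cvgrPdist_lt/(_ _ e20) := part_cvg.
apply: filterS => s; rewrite sub0r normrN => /(le_lt_trans (ler_norm _)) sN.
apply: le_lt_trans (limn_series_le_dominated N (delta_term_le x (h s))
  (is_cvg_delta (x := x) (y := h s)) ca) _.
by rewrite [e]splitr ltrD.
Qed.

End metric_limit_topology.

Theorem proposition1 (R : realType) (k : nat) (X : compact_complex_manifold R k)
    (f : dominant_map X) (T : tower f) (D : limit_metric T) :
  continuous (sigma T : metric_limit D -> metric_limit D).
Proof.
move=> x; apply: (cvg_metric_limit (FF := nbhs_filter x)) => n.
have [s_cont _] := tower_s_holomorphic T n.
pose p (y : metric_limit D) : tower_space T n.+1 := coord y n.+1.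
have p_cont : {for x, continuous p} by exact: coord_continuous.
exact: (@continuous_comp _ _ _ p (@tower_s _ _ _ _ T n) x p_cont (s_cont _)).
Qed.
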